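(* Let $\mathcal{C}$ and $\mathcal{D}$ be categories, each equipped with a class of weak equivalences $\mathcal{W}$, and let $F:\mathcal{C}\rightleftarrows\mathcal{D}:G$ be a pair of adjoint functors ($F$ left adjoint to $G$) with adjunction morphisms $a:FG\to 1_{\mathcal{D}}$ and $b:1_{\mathcal{C}}\to GF$. Assume that the absolute right derived functor $(\mathbb{R}G,\ \eta:\gamma_{\mathcal{C}}G\to\mathbb{R}G\,\gamma_{\mathcal{D}})$ of $G$ exists. If $\mathbb{R}G:\mathcal{D}[\mathcal{W}^{-1}]\to\mathcal{C}[\mathcal{W}^{-1}]$ admits a left adjoint $F':\mathcal{C}[\mathcal{W}^{-1}]\to\mathcal{D}[\mathcal{W}^{-1}]$, with adjunction morphisms $a':F'\,\mathbb{R}G\to 1$ and $b':1\to\mathbb{R}G\,F'$, then the absolute left derived functor $\mathbb{L}F$ of $F$ exists and it agrees with $F'$. In addition, the unit $\epsilon:F'\gamma_{\mathcal{C}}\to\gamma_{\mathcal{D}}F$ exhibiting $F'$ as the absolute left derived functor of $F$ may be chosen in such a way that $$(a'\gamma_{\mathcal{D}})\circ(F'\eta)=(\gamma_{\mathcal{D}}a)\circ(\epsilon G):\ F'\gamma_{\mathcal{C}}G\to\gamma_{\mathcal{D}}$$ and $$(\mathbb{R}G\,\epsilon)\circ(b'\gamma_{\mathcal{C}})=(\eta F)\circ(\gamma_{\mathcal{C}}b):\ \gamma_{\mathcal{C}}\to\mathbb{R}G\,\gamma_{\mathcal{D}}F .$$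
   Context: Composition of functors and whiskering of natural transformations by functors are written by juxtaposition; $\circ$ is vertical composition of natural transformations. A right Kan extension of $T:\mathcal{M}\to\mathcal{A}$ along $K:\mathcal{M}\to\mathcal{X}$ is a functor $Ran_KT:\mathcal{X}\to\mathcal{A}$ with a natural transformation (''unit'') $\epsilon:(Ran_KT)K\to T$ such that for every $L:\mathcal{X}\to\mathcal{A}$ the map $\mathrm{Nat}(L,Ran_KT)\to\mathrm{Nat}(LK,T)$, $\lambda\mapsto\epsilon\circ(\lambda K)$, is bijective. It is absolute if for every functor $S:\mathcal{A}\to\mathcal{B}$ the pair $(S\,Ran_KT,\ S\epsilon)$ is a right Kan extension of $ST$ along $K$. (Absolute) left Kan extensions $(Lan_KT,\ \eta:T\to(Lan_KT)K)$ are defined dually. A category $\mathcal{C}$ is equipped with an arbitrary class $\mathcal{W}$ of morphisms, called weak equivalences (the same letter is used for all categories). $\gamma_{\mathcal{C}}:\mathcal{C}\to\mathcal{C}[\mathcal{W}^{-1}]$ is the localization obtained by formally inverting $\mathcal{W}$ (a possibly large category): $\gamma_{\mathcal{C}}$ sends $\mathcal{W}$ to isomorphisms and precomposition with $\gamma_{\mathcal{C}}$ is an equivalence from functors $\mathcal{C}[\mathcal{W}^{-1}]\to\mathcal{E}$ to functors $\mathcal{C}\to\mathcal{E}$ sending $\mathcal{W}$ to isomorphisms, for every category $\mathcal{E}$. For $F:\mathcal{C}\to\mathcal{D}$, the absolute left derived functor of $F$ is the absolute right Kan extension $\mathbb{L}F=Ran_{\gamma_{\mathcal{C}}}(\gamma_{\mathcal{D}}F)$,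 with unit $\epsilon:\mathbb{L}F\,\gamma_{\mathcal{C}}\to\gamma_{\mathcal{D}}F$. For $G:\mathcal{D}\to\mathcal{C}$, the absolute right derived functor of $G$ is the absolute left Kan extension $\mathbb{R}G=Lan_{\gamma_{\mathcal{D}}}(\gamma_{\mathcal{C}}G)$, with unit $\eta:\gamma_{\mathcal{C}}G\to\mathbb{R}G\,\gamma_{\mathcal{D}}$. ''$\mathbb{L}F$ agrees with $F'$'' means that $F'$, with a suitable unit, is such an absolute right Kan extension. *)

(* Defs.v *)
From Stdlib Require Import ssreflect ssrfun.
From Stdlib Require Import FunctionalExtensionality ProofIrrelevance.

Set Implicit Arguments.
Unset Strict Implicit.
Unset Printing Implicit Defensive.

Declare Scope cat_scope.
Delimit Scope cat_scope with cat.
Local Open Scope cat_scope.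

(* Objects and morphisms may live in the same (arbitrarily large) universe, so
   that functor categories and localizations are again of type [Category]. *)
Record Category : Type := MkCategory {
  Ob :> Type;
  Hom : Ob -> Ob -> Type;
  idm : forall x, Hom x x;
  compm : forall x y z, Hom y z -> Hom x y -> Hom x z;
  comp1m : forall x y (f : Hom x y), compm (idm y) f = f;
  compm1 : forall x y (f : Hom x y), compm f (idm x) = f;
  compmA : forall x y z t (h : Hom z t) (g : Hom y z) (f : Hom x y),
    compm h (compm g f) = compm (compm h g) f
}.
Arguments Hom {_} _ _.
Arguments idm {_} _.
Arguments compm {_ _ _ _} _ _.

Notation "g ⊙ f" := (compm g f) (at level 40, left associativity) : cat_scope.

Record Functor (C D : Category) : Type := MkFunctor {
  Fob :> C -> D;
  Fmap : forall x y : C, Hom x y -> Hom (Fob x) (Fob y);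
  Fmap1 : forall x : C, Fmap (idm x) = idm (Fob x);
  FmapM : forall (x y z : C) (g : Hom y z) (f : Hom x y),
    Fmap (g ⊙ f) = Fmap g ⊙ Fmap f
}.
Arguments Fmap {_ _} _ {_ _} _.

Lemma fcomp_map1 (C D E : Category) (G : Functor D E) (F : Functor C D) (x : C) :
  Fmap G (Fmap F (idm x)) = idm (G (F x)).
Proof. by rewrite !Fmap1. Qed.

Lemma fcomp_mapM (C D E : Category) (G : Functor D E) (F : Functor C D)
    (x y z : C) (g : Hom y z) (f : Hom x y) :
  Fmap G (Fmap F (g ⊙ f)) = Fmap G (Fmap F g) ⊙ Fmap G (Fmap F f).
Proof. by rewrite !FmapM. Qed.

Definition fid (C : Category) : Functor C C :=
  @MkFunctor C C (fun x => x) (fun x y f => f)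
    (fun x => erefl) (fun x y z g f => erefl).

Definition fcomp (C D E : Category) (G : Functor D E) (F : Functor C D) :
    Functor C E :=
  @MkFunctor C E (fun x => G (F x)) (fun x y f => Fmap G (Fmap F f))
    (fcomp_map1 G F) (@fcomp_mapM C D E G F).

Notation "G ∘ F" := (fcomp G F) (at level 40, left associativity) : cat_scope.

Definition natural (C D : Category) (F G : Functor C D)
    (t : forall x : C, Hom (F x) (G x)) : Prop :=
  forall (x y : C) (f : Hom x y), Fmap G f ⊙ t x = t y ⊙ Fmap F f.

(* A subset type rather than a record: [NatTrans F G] then depends on [F] and
   [G] only through their actions on objects and morphisms, so that, e.g.,
   [NatTrans ((H ∘ G) ∘ F) T] and [NatTrans (H ∘ (G ∘ F)) T], or [NatTrans F T]
   and [NatTrans (fid D ∘ F) T], are convertible, and no associativity or unit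
   constraints are needed below. *)
Definition NatTrans (C D : Category) (F G : Functor C D) : Type :=
  {t : forall x : C, Hom (F x) (G x) | natural t}.

Notation "F ⟹ G" := (NatTrans F G) (at level 70, no associativity) : cat_scope.

Lemma nt_ext (C D : Category) (F G : Functor C D) (s t : F ⟹ G) :
  (forall x, sval s x = sval t x) -> s = t.
Proof.
move: s t => [s hs] [t ht] /= st.
by apply: subset_eq_compat; apply: functional_extensionality_dep.
Qed.

Lemma ntid_nat (C D : Category) (F : Functor C D) :
  @natural C D F F (fun x => idm (F x)).
Proof. by move=> x y f; rewrite compm1 comp1m. Qed.

Definition ntid (C D : Category) (F : Functor C D) : F ⟹ F :=
  exist _ (fun x => idm (F x)) (@ntid_nat C D F).

Lemma vcomp_nat (C D : Category) (F G H : Functor C D) (t : G ⟹ H) (s : F ⟹ G) :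
  @natural C D F H (fun x => sval t x ⊙ sval s x).
Proof.
move: t s => [t ht] [s hs] x y f /=.
by rewrite compmA ht -!compmA hs.
Qed.

Definition vcomp (C D : Category) (F G H : Functor C D)
    (t : G ⟹ H) (s : F ⟹ G) : F ⟹ H :=
  exist _ (fun x => sval t x ⊙ sval s x) (vcomp_nat t s).

Notation "t • s" := (vcomp t s) (at level 45, left associativity) : cat_scope.

Lemma whiskerl_nat (C D E : Category) (S : Functor D E) (F G : Functor C D)
    (t : F ⟹ G) :
  @natural C E (S ∘ F) (S ∘ G) (fun x => Fmap S (sval t x)).
Proof. by move: t => [t ht] x y f /=; rewrite -!FmapM ht. Qed.

Definition whiskerl (C D E : Category) (S : Functor D E) (F G : Functor C D)
    (t : F ⟹ G) : S ∘ F ⟹ S ∘ G :=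
  exist _ (fun x => Fmap S (sval t x)) (whiskerl_nat S t).

Lemma whiskerr_nat (C D E : Category) (F G : Functor D E) (t : F ⟹ G)
    (K : Functor C D) :
  @natural C E (F ∘ K) (G ∘ K) (fun x => sval t (K x)).
Proof. by move: t => [t ht] x y f /=; rewrite ht. Qed.

Definition whiskerr (C D E : Category) (F G : Functor D E) (t : F ⟹ G)
    (K : Functor C D) : F ∘ K ⟹ G ∘ K :=
  exist _ (fun x => sval t (K x)) (whiskerr_nat t K).

Notation "S ◁ t" := (whiskerl S t) (at level 41, right associativity) : cat_scope.
Notation "t ▷ K" := (whiskerr t K) (at level 42, left associativity) : cat_scope.

Definition is_adjunction (C D : Category) (F : Functor C D) (G : Functor D C)
    (a : F ∘ G ⟹ fid D) (b : fid C ⟹ G ∘ F) : Prop :=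
  (((a ▷ F) • (F ◁ b) : F ⟹ F) = ntid F) /\
  (((G ◁ a) • (b ▷ G) : G ⟹ G) = ntid G).

Definition is_right_Kan (M X A : Category) (K : Functor M X) (T : Functor M A)
    (R : Functor X A) (eps : R ∘ K ⟹ T) : Prop :=
  forall L : Functor X A, bijective (fun l : L ⟹ R => eps • (l ▷ K)).

Definition is_left_Kan (M X A : Category) (K : Functor M X) (T : Functor M A)
    (L : Functor X A) (eta : T ⟹ L ∘ K) : Prop :=
  forall R : Functor X A, bijective (fun l : L ⟹ R => (l ▷ K) • eta).

Definition is_absolute_right_Kan (M X A : Category) (K : Functor M X)
    (T : Functor M A) (R : Functor X A) (eps : R ∘ K ⟹ T) : Prop :=
  is_right_Kan eps /\
  forall (B : Category) (S : Functor A B),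
    @is_right_Kan M X B K (S ∘ T) (S ∘ R) (S ◁ eps).

Definition is_absolute_left_Kan (M X A : Category) (K : Functor M X)
    (T : Functor M A) (L : Functor X A) (eta : T ⟹ L ∘ K) : Prop :=
  is_left_Kan eta /\
  forall (B : Category) (S : Functor A B),
    @is_left_Kan M X B K (S ∘ T) (S ∘ L) (S ◁ eta).

Definition MorClass (C : Category) : Type := forall x y : C, Hom x y -> Prop.

Definition is_iso (C : Category) (x y : C) (f : Hom x y) : Prop :=
  exists g : Hom y x, g ⊙ f = idm x /\ f ⊙ g = idm y.

Definition inverts (C E : Category) (W : MorClass C) (F : Functor C E) : Prop :=
  forall (x y : C) (f : Hom x y), W x y f -> is_iso (Fmap F f).

Lemma vcomp1t (C D : Category) (F G : Functor C D) (t : F ⟹ G) : ntid G • t = t.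
Proof. by apply: nt_ext => x /=; rewrite comp1m. Qed.

Lemma vcompt1 (C D : Category) (F G : Functor C D) (t : F ⟹ G) : t • ntid F = t.
Proof. by apply: nt_ext => x /=; rewrite compm1. Qed.

Lemma vcompA (C D : Category) (F G H K : Functor C D)
    (u : H ⟹ K) (t : G ⟹ H) (s : F ⟹ G) : u • (t • s) = (u • t) • s.
Proof. by apply: nt_ext => x /=; rewrite compmA. Qed.

Definition FunCat (C E : Category) : Category :=
  @MkCategory (Functor C E) (@NatTrans C E) (@ntid C E) (@vcomp C E)
    (@vcomp1t C E) (@vcompt1 C E) (@vcompA C E).

Definition FullSub (C : Category) (P : C -> Prop) : Category :=
  @MkCategory {x : C | P x} (fun x y => Hom (sval x) (sval y))
    (fun x => idm (sval x)) (fun x y z g f => g ⊙ f)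
    (fun x y f => comp1m f) (fun x y f => compm1 f)
    (fun x y z t h g f => compmA h g f).

Definition InvFunCat (C : Category) (W : MorClass C) (E : Category) : Category :=
  @FullSub (FunCat C E) (inverts W).

Lemma inverts_fcomp (C L E : Category) (W : MorClass C) (g : Functor C L)
    (H : Functor L E) : inverts W g -> inverts W (H ∘ g).
Proof.
move=> Wg x y f /Wg [h [hf fh]]; exists (Fmap H h).
by rewrite /= -!FmapM hf fh !Fmap1.
Qed.

Lemma whiskerr_id (C L E : Category) (g : Functor C L) (H : Functor L E) :
  ntid H ▷ g = ntid (H ∘ g).
Proof. exact: nt_ext. Qed.

Lemma whiskerr_vcomp (C L E : Category) (g : Functor C L) (H I J : Functor L E)
    (t : I ⟹ J) (s : H ⟹ I) : (t • s) ▷ g = (t ▷ g) • (s ▷ g).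
Proof. exact: nt_ext. Qed.

Definition precomp (C L : Category) (W : MorClass C) (g : Functor C L)
    (Wg : inverts W g) (E : Category) : Functor (FunCat L E) (InvFunCat W E) :=
  @MkFunctor (FunCat L E) (InvFunCat W E)
    (fun H : Functor L E => exist _ (H ∘ g) (inverts_fcomp H Wg))
    (fun (H I : Functor L E) (t : H ⟹ I) => t ▷ g)
    (fun H => whiskerr_id g H)
    (fun H I J t s => whiskerr_vcomp g t s).

Definition is_equivalence (C D : Category) (F : Functor C D) : Prop :=
  exists (G : Functor D C) (u : G ∘ F ⟹ fid C) (v : F ∘ G ⟹ fid D),
    (forall x : C, is_iso (sval u x)) /\ (forall y : D, is_iso (sval v y)).

(* [L], with [g], is the category C[W^-1] obtained by formally inverting [W]. *)
Definition is_localization (C : Category) (W : MorClass C) (L : Category)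
    (g : Functor C L) : Prop :=
  exists Wg : inverts W g, forall E : Category, is_equivalence (precomp Wg E).

Definition is_absolute_left_derived (C D LC LD : Category)
    (gC : Functor C LC) (gD : Functor D LD) (F : Functor C D)
    (LF : Functor LC LD) (eps : LF ∘ gC ⟹ gD ∘ F) : Prop :=
  @is_absolute_right_Kan C LC LD gC (gD ∘ F) LF eps.

Definition is_absolute_right_derived (C D LC LD : Category)
    (gC : Functor C LC) (gD : Functor D LD) (G : Functor D C)
    (RG : Functor LD LC) (eta : gC ∘ G ⟹ RG ∘ gD) : Prop :=
  @is_absolute_left_Kan D LD LC gD (gC ∘ G) RG eta.
Arguments is_adjunction {_ _} F G a b.
Arguments is_absolute_left_derived {_ _ _ _} gC gD F LF eps.
Arguments is_absolute_right_derived {_ _ _ _} gC gD G RG eta.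

(* Main.v *)
From Stdlib Require Import ssreflect ssrfun.
Require Import Defs.

(** An adjunction [F ⊣ G] makes precomposition with [G] left adjoint to
    precomposition with [F]: transformations [X ∘ G ⟹ Y] correspond to
    transformations [X ⟹ Y ∘ F].  This gives, for all [L : LC -> B] and
    [S : LD -> B], three bijections

      [Nat(L, S F') ≅ Nat(L RG, S) ≅ Nat(L gC G, S gD) ≅ Nat(L gC, S gD F)],

    the outer ones from [F' ⊣ RG] and [F ⊣ G] ([untranspose_bij],
    [transpose_bij]), the middle one because [L] preserves the left Kan
    extension [RG] of [gC ∘ G] along [gD].  Absoluteness is essential
    here: [L] is the test functor of the universal property of [F'], but it
    acts on [RG] by postcomposition.

    For [L = F'] and [S] the identity functor, the composite takes the identity
    of [F'] to the mate of [eta],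

      [eps = (a' gD F) • (F' eta F) • (F' gC b) : F' gC ⟹ gD F],

    and the naturality of [l : L ⟹ S F'] shows that the composite sends every
    [l] to [(S eps) • (l gC)] ([mate_right_Kan]).  So [eps] exhibits [F'] as a
    right Kan extension, preserved by every [S].  The two compatibility
    equations say that [eps] and [eta] are mates, and follow from the triangle
    identities of [F ⊣ G] and of [F' ⊣ RG] respectively. *)

Set Implicit Arguments.
Unset Strict Implicit.
Unset Printing Implicit Defensive.
Local Open Scope cat_scope.

Lemma naturality (C D : Category) (F G : Functor C D) (t : F ⟹ G)
    (x y : C) (f : Hom x y) :
  Fmap G f ⊙ sval t x = sval t y ⊙ Fmap F f.
Proof. exact: (svalP t). Qed.

Section Transposition.
Context (C D : Category) (F : Functor C D) (G : Functor D C).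
Context (a : F ∘ G ⟹ fid D) (b : fid C ⟹ G ∘ F).

Lemma triangle_left : is_adjunction F G a b ->
  forall x : C, sval a (F x) ⊙ Fmap F (sval b x) = idm (F x).
Proof. by case=> h _ x; exact: (f_equal (fun t : F ⟹ F => sval t x) h). Qed.

Lemma triangle_right : is_adjunction F G a b ->
  forall y : D, Fmap G (sval a y) ⊙ sval b (G y) = idm (G y).
Proof. by case=> _ h y; exact: (f_equal (fun t : G ⟹ G => sval t y) h). Qed.

Section Functors.
Context (E : Category) (X : Functor C E) (Y : Functor D E).

Definition transpose (t : X ∘ G ⟹ Y) : X ⟹ Y ∘ F := (t ▷ F) • (X ◁ b).

Definition untranspose (s : X ⟹ Y ∘ F) : X ∘ G ⟹ Y := (Y ◁ a) • (s ▷ G).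

Lemma transposeK : is_adjunction F G a b -> cancel transpose untranspose.
Proof.
move=> adj t; apply: nt_ext => y /=.
by rewrite compmA (naturality t) -compmA -FmapM triangle_right // Fmap1 compm1.
Qed.

Lemma untransposeK : is_adjunction F G a b -> cancel untranspose transpose.
Proof.
move=> adj s; apply: nt_ext => x /=.
rewrite -compmA -(naturality s) compmA /= -FmapM.
by rewrite triangle_left // Fmap1 comp1m.
Qed.

Lemma transpose_bij : is_adjunction F G a b -> bijective transpose.
Proof. by move=> adj; exists untranspose; [exact: transposeK | exact: untransposeK]. Qed.

Lemma untranspose_bij : is_adjunction F G a b -> bijective untranspose.
Proof. by move=> adj; exists transpose; [exact: untransposeK | exact: transposeK]. Qed.

End Functors.
End Transposition.

Section Mate.
Context (C D LC LD : Category) (gC : Functor C LC) (gD : Functor D LD).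
Context (F : Functor C D) (G : Functor D C).
Context (a : F ∘ G ⟹ fid D) (b : fid C ⟹ G ∘ F).
Context (F' : Functor LC LD) (RG : Functor LD LC).
Context (a' : F' ∘ RG ⟹ fid LD) (b' : fid LC ⟹ RG ∘ F').
Context (eta : gC ∘ G ⟹ RG ∘ gD).

Definition mate : F' ∘ gC ⟹ gD ∘ F :=
  transpose b (X := F' ∘ gC) (Y := gD) ((a' ▷ gD) • (F' ◁ eta)).

(** The right-hand side transposes [mate] back along [F ⊣ G]. *)
Lemma mate_counit : is_adjunction F G a b ->
  ((a' ▷ gD) • (F' ◁ eta) : F' ∘ gC ∘ G ⟹ gD) = (gD ◁ a) • (mate ▷ G).
Proof. by move=> adj; rewrite -[LHS](transposeK adj (X := F' ∘ gC) (Y := gD)). Qed.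

(** Naturality of [b'] moves it past [eta] and [b], next to [RG a'], where the
    triangle identity cancels the two. *)
Lemma mate_unit : is_adjunction F' RG a' b' ->
  ((RG ◁ mate) • (b' ▷ gC) : gC ⟹ RG ∘ gD ∘ F) = (eta ▷ F) • (gC ◁ b).
Proof.
move=> adj'; apply: nt_ext => x /=.
have nat_b' := naturality b' (sval eta (F x) ⊙ Fmap gC (sval b x)).
rewrite /= in nat_b'; rewrite -compmA -FmapM FmapM -compmA nat_b'.
by rewrite compmA (triangle_right adj') comp1m.
Qed.

(** All [L : LC -> B] must be allowed in the hypothesis: they are the test
    functors of the conclusion.  [S] plays the opposite role: it is only a test
    functor for the left Kan extensions [L ∘ RG]. *)
Lemma mate_right_Kan (B : Category) (S : Functor LD B) :
  is_adjunction F G a b -> is_adjunction F' RG a' b' ->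
  (forall L : Functor LC B,
     @is_left_Kan D LD B gD (L ∘ (gC ∘ G)) (L ∘ RG) (L ◁ eta)) ->
  @is_right_Kan C LC B gC (S ∘ (gD ∘ F)) (S ∘ F') (S ◁ mate).
Proof.
move=> adj adj' kan L.
pose restrict (u : L ∘ RG ⟹ S) : (L ∘ gC) ∘ G ⟹ S ∘ gD :=
  (u ▷ gD) • (L ◁ eta).
have restrict_bij : bijective restrict by exact: kan L S.
have all_bij := bij_comp (transpose_bij (L ∘ gC) (S ∘ gD) adj)
  (bij_comp restrict_bij (untranspose_bij L S adj')).
apply: (eq_bij all_bij) => l; apply: nt_ext => x /=.
(* Up to [S (a' _)], one side has [L (eta • b)] before [l], the other has
   [S F' (eta • b)] after it: naturality of [l] exchanges them. *)
have nat_l := naturality l (sval eta (F x) ⊙ Fmap gC (sval b x)).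
by rewrite /= !FmapM -!compmA in nat_l *; rewrite nat_l.
Qed.

End Mate.

Theorem theorem3p1
  (C D : Category) (WC : MorClass C) (WD : MorClass D)
  (LC LD : Category) (gC : Functor C LC) (gD : Functor D LD)
  (hgC : is_localization WC gC) (hgD : is_localization WD gD)
  (F : Functor C D) (G : Functor D C)
  (a : F ∘ G ⟹ fid D) (b : fid C ⟹ G ∘ F) (hFG : is_adjunction F G a b)
  (RG : Functor LD LC) (eta : gC ∘ G ⟹ RG ∘ gD)
  (hRG : is_absolute_right_derived gC gD G RG eta)
  (F' : Functor LC LD)
  (a' : F' ∘ RG ⟹ fid LD) (b' : fid LC ⟹ RG ∘ F')
  (hF'RG : is_adjunction F' RG a' b') :
  exists eps : F' ∘ gC ⟹ gD ∘ F,
    is_absolute_left_derived gC gD F F' eps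
    /\ ((a' ▷ gD) • (F' ◁ eta) : F' ∘ gC ∘ G ⟹ gD)
       = (gD ◁ a) • (eps ▷ G)
    /\ ((RG ◁ eps) • (b' ▷ gC) : gC ⟹ RG ∘ gD ∘ F)
       = (eta ▷ F) • (gC ◁ b).
Proof.
have [_ kan] := hRG.
exists (mate b a' eta); split; last first.
  by split; [exact: mate_counit hFG | exact: mate_unit hF'RG].
split; last by move=> B S; apply: (mate_right_Kan S hFG hF'RG) => L; exact: kan.
(* The case [S = fid LD]: whiskering by it changes only the naturality proof. *)
move=> L; have bij := mate_right_Kan (fid LD) hFG hF'RG (fun K => kan LD K) L.
by apply: (eq_bij bij) => l; exact: nt_ext.
Qed.
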